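(* Let $\Gamma\in\mathcal{T}_3$. Let $\widetilde q_1,\widetilde q_2,\widetilde q_3$ be the first, second and third elementary symmetric functions of the eigenvalues of $\Gamma^{*2}$: $\widetilde q_1=\mathrm{Trace}\,\Gamma^{*2}$, $\widetilde q_2=$ the sum of the three principal $2\times2$ minors of $\Gamma^{*2}$, $\widetilde q_3=\det\Gamma^{*2}$. Then $\Gamma$ is fully decoupleable if and only if the following $13$ relations hold (all invariants evaluated at $\Gamma$): \begin{align*} H_2&=10\widetilde q_1,\\ H_4&=2(22\widetilde q_1^2-15\widetilde q_2),\\ J_2&=\widetilde q_1,\\ L_4&=2(\widetilde q_1^2-5\widetilde q_2),\\ H_6&=4(16\widetilde q_1^3-55\widetilde q_1\widetilde q_2+75\widetilde q_3),\\ H_{10}&=8(128\widetilde q_1^5-700\widetilde q_1^3\widetilde q_2+725\widetilde q_1\widetilde q_2^2+950\widetilde q_1^2\widetilde q_3-875\widetilde q_2\widetilde q_3),\\ J_4&=2(3\widetilde q_1^2-5\widetilde q_2),\\ K_4&=4(2\widetilde q_1^2-5\widetilde q_2),\\ J_6&=12\widetilde q_1^3-55\widetilde q_1\widetilde q_2+75\widetilde q_3,\\ K_6&=2(8\widetilde q_1^3-35\widetilde q_1\widetilde q_2+75\widetilde q_3),\\ L_6&=6(8\widetilde q_1^3-25\widetilde q_1\widetilde q_2+25\widetilde q_3),\\ M_6&=4\widetilde q_1^3-15\widetilde q_1\widetilde q_2+75\widetilde q_3,\\ H_8&=4(72\widetilde q_1^4-270\widetilde q_1^2\widetilde q_2+75\widetilde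 q_2^2+325\widetilde q_1\widetilde q_3). \end{align*}
   Context: $\mathcal{T}_3$ is the set of real $3\times3\times3$ tensors $\Gamma=(\Gamma^i_{jk})$ that are trilinear (completely symmetric), i.e. $\Gamma^i_{jk}=\Gamma^i_{kj}=\Gamma^j_{ik}$. The group $O(3)$ acts by $(\sigma\circ\Gamma)^i_{jk}=\sum_{i',j',k'}\sigma_{ii'}\sigma_{jj'}\sigma_{kk'}\Gamma^{i'}_{j'k'}$. $\Gamma$ is fully decoupleable if there is $\sigma\in O(3)$ with $(\sigma\circ\Gamma)^i_{jk}=0$ unless $i=j=k$. $\Gamma^{*2}$ is the symmetric $3\times3$ matrix $\Gamma^{*2}_{k\ell}=\sum_{i,j}\Gamma^i_{jk}\Gamma^i_{j\ell}$. Given $\Gamma$, define the trace vector $u\in\mathbb{R}^3$, $u_i=\sum_{\ell}\Gamma^i_{\ell\ell}$, and the trace-free completely symmetric tensor $D$ with entries $D_{ijk}=5\Gamma^i_{jk}-(u_i\delta_{jk}+u_j\delta_{ik}+u_k\delta_{ij})$. With summation over all repeated indices, define the vectors $v_m=D_{ijk}D_{ij\ell}D_{k\ell m}$, $w_m=D_{ijm}u_iu_j$, and the invariants \begin{align*} &H_2=D_{ijk}D_{ijk},\quad J_2=u_iu_i,\quad H_4=D_{ijk}D_{ij\ell}D_{pqk}D_{pq\ell},\\ &J_4=D_{ijk}u_kD_{ij\ell}u_\ell,\quad K_4=D_{ijk}D_{ij\ell}D_{k\ell p}u_p,\quad L_4=D_{ijk}u_iu_ju_k,\\ &H_6=v_iv_i,\quad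 J_6=D_{ijk}D_{ij\ell}u_kD_{\ell pq}u_pu_q,\quad K_6=v_kw_k,\\ &L_6=D_{ijk}D_{ij\ell}u_kv_\ell,\quad M_6=D_{ijk}D_{pqk}u_iu_ju_pu_q,\\ &H_8=D_{ijk}D_{ij\ell}u_kD_{pq\ell}D_{pqr}v_r,\quad H_{10}=D_{ijk}v_iv_jv_k. \end{align*} *)

(* Defs.v *)
From mathcomp Require Import all_boot all_order all_algebra.
From mathcomp Require Import reals.

Set Implicit Arguments.
Unset Strict Implicit.
Unset Printing Implicit Defensive.

Import GRing.Theory.
Local Open Scope ring_scope.

(* [G i j k] is the entry with upper index i and lower indices j, k. *)
Definition tensor3 (R : realType) : Type := 'I_3 -> 'I_3 -> 'I_3 -> R.

Definition trilinear (R : realType) (G : tensor3 R) : Prop :=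
  forall i j k, G i j k = G i k j /\ G i k j = G j i k.

Definition orthogonal_mx (R : realType) (s : 'M[R]_3) : Prop :=
  s^T *m s = 1%:M.

Definition tensor_act (R : realType) (s : 'M[R]_3) (G : tensor3 R) : tensor3 R :=
  fun i j k =>
    \sum_(i' < 3) \sum_(j' < 3) \sum_(k' < 3)
      s i i' * s j j' * s k k' * G i' j' k'.

Definition fully_decoupleable (R : realType) (G : tensor3 R) : Prop :=
  exists s : 'M[R]_3, orthogonal_mx s /\
    forall i j k, ~ (i = j /\ j = k) -> tensor_act s G i j k = 0.

Definition star2 (R : realType) (G : tensor3 R) : 'M[R]_3 :=
  \matrix_(k < 3, l < 3) \sum_(i < 3) \sum_(j < 3) G i j k * G i j l.

Definition q1 (R : realType) (G : tensor3 R) : R := \tr (star2 G).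

(* Each principal 2 x 2 minor deletes the row and the column of one index m. *)
Definition q2 (R : realType) (G : tensor3 R) : R :=
  \sum_(m < 3) \det (row' m (col' m (star2 G))).

Definition q3 (R : realType) (G : tensor3 R) : R := \det (star2 G).

Definition tvec (R : realType) (G : tensor3 R) (i : 'I_3) : R :=
  \sum_(l < 3) G i l l.

Definition tfree (R : realType) (G : tensor3 R) : tensor3 R :=
  fun i j k =>
    let u := tvec G in
    5 * G i j k
    - (u i * (j == k)%:R + u j * (i == k)%:R + u k * (i == j)%:R).

Definition vvec (R : realType) (G : tensor3 R) (m : 'I_3) : R :=
  let D := tfree G in
  \sum_(i < 3) \sum_(j < 3) \sum_(k < 3) \sum_(l < 3)
    D i j k * D i j l * D k l m.

Definition wvec (R : realType) (G : tensor3 R) (m : 'I_3) : R :=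
  let D := tfree G in let u := tvec G in
  \sum_(i < 3) \sum_(j < 3) D i j m * u i * u j.

Definition H2 (R : realType) (G : tensor3 R) : R :=
  let D := tfree G in
  \sum_(i < 3) \sum_(j < 3) \sum_(k < 3) D i j k * D i j k.

Definition J2 (R : realType) (G : tensor3 R) : R :=
  let u := tvec G in
  \sum_(i < 3) u i * u i.

Definition H4 (R : realType) (G : tensor3 R) : R :=
  let D := tfree G in
  \sum_(i < 3) \sum_(j < 3) \sum_(k < 3) \sum_(l < 3)
  \sum_(p < 3) \sum_(q < 3)
    D i j k * D i j l * D p q k * D p q l.

Definition J4 (R : realType) (G : tensor3 R) : R :=
  let D := tfree G in let u := tvec G in
  \sum_(i < 3) \sum_(j < 3) \sum_(k < 3) \sum_(l < 3)
    D i j k * u k * D i j l * u l.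

Definition K4 (R : realType) (G : tensor3 R) : R :=
  let D := tfree G in let u := tvec G in
  \sum_(i < 3) \sum_(j < 3) \sum_(k < 3) \sum_(l < 3) \sum_(p < 3)
    D i j k * D i j l * D k l p * u p.

Definition L4 (R : realType) (G : tensor3 R) : R :=
  let D := tfree G in let u := tvec G in
  \sum_(i < 3) \sum_(j < 3) \sum_(k < 3) D i j k * u i * u j * u k.

Definition H6 (R : realType) (G : tensor3 R) : R :=
  let v := vvec G in
  \sum_(i < 3) v i * v i.

Definition J6 (R : realType) (G : tensor3 R) : R :=
  let D := tfree G in let u := tvec G in
  \sum_(i < 3) \sum_(j < 3) \sum_(k < 3) \sum_(l < 3)
  \sum_(p < 3) \sum_(q < 3)
    D i j k * D i j l * u k * D l p q * u p * u q.

Definition K6 (R : realType) (G : tensor3 R) : R :=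
  let v := vvec G in let w := wvec G in
  \sum_(k < 3) v k * w k.

Definition L6 (R : realType) (G : tensor3 R) : R :=
  let D := tfree G in let u := tvec G in let v := vvec G in
  \sum_(i < 3) \sum_(j < 3) \sum_(k < 3) \sum_(l < 3)
    D i j k * D i j l * u k * v l.

Definition M6 (R : realType) (G : tensor3 R) : R :=
  let D := tfree G in let u := tvec G in
  \sum_(i < 3) \sum_(j < 3) \sum_(k < 3) \sum_(p < 3) \sum_(q < 3)
    D i j k * D p q k * u i * u j * u p * u q.

Definition H8 (R : realType) (G : tensor3 R) : R :=
  let D := tfree G in let u := tvec G in let v := vvec G in
  \sum_(i < 3) \sum_(j < 3) \sum_(k < 3) \sum_(l < 3)
  \sum_(p < 3) \sum_(q < 3) \sum_(r < 3)
    D i j k * D i j l * u k * D p q l * D p q r * v r.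

Definition H10 (R : realType) (G : tensor3 R) : R :=
  let D := tfree G in let v := vvec G in
  \sum_(i < 3) \sum_(j < 3) \sum_(k < 3) D i j k * v i * v j * v k.

(* Main.v *)
Require Import Defs.
From mathcomp Require Import all_boot all_order all_algebra.
From mathcomp Require Import complex spectral boolp reals ring.

Set Implicit Arguments.
Unset Strict Implicit.
Unset Printing Implicit Defensive.

Import Order.TTheory GRing.Theory Num.Theory.
Local Open Scope ring_scope.

(**
  A symmetric tensor is fully decoupleable iff its slices
  [G_k = (G i j k)_(i,j)] commute pairwise: commuting real symmetric matrices
  have a common orthonormal eigenbasis, and in that basis complete symmetry
  kills every off-diagonal entry.
  The sum [N] of the squared norms of all commutators [G_k, G_l] is an
  O(3)-invariant of degree 4, and
    625 N = - H2^2 - 4 H2 J2 + 36 J2^2 + 4 H4 - 4 J4 - 8 K4 + 8 L4.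
  The relations of degree at most 4 make the right-hand side vanish, which gives
  the converse implication.  For the direct one, every invariant is an
  expression in [M = D^{*2}], [u], [v], [w], all of which are O(3)-equivariant,
  so that it suffices to evaluate them at a diagonal tensor.
*)

(** * Simultaneous orthogonal diagonalisation *)

Section RealSpectral.
Variable R : rcfType.

Lemma row_sqnorm_gt0 n (v : 'rV[R]_n) : v != 0 -> 0 < (v *m v^T) 0 0.
Proof.
move=> v0; have [i vi] : exists i, v 0 i != 0.
  by apply/existsP; apply: contraNT v0 => /existsPn h; apply/eqP/rowP => i;
     rewrite mxE; apply/eqP; have := h i; rewrite negbK.
rewrite mxE (bigD1 i) //= mxE ltr_pwDl //.
  by rewrite -expr2 exprn_even_gt0.
by apply: sumr_ge0 => j _; rewrite mxE -expr2 sqr_ge0.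
Qed.

Lemma row_sqnorm_ge0 n (v : 'rV[R]_n) : 0 <= (v *m v^T) 0 0.
Proof.
by have [->|/row_sqnorm_gt0/ltW //] := eqVneq v 0; rewrite mul0mx mxE.
Qed.

(* A complex eigenvalue p + iq of a real symmetric matrix, with eigenvector
   a + ib, satisfies q (|a|^2 + |b|^2) = 0. *)
Lemma symmetric_eigenvalue_real n (A : 'M[R]_n) (a b : 'rV[R]_n) (p q : R) :
  A^T = A -> (a != 0) || (b != 0) ->
  a *m A = p *: a - q *: b -> b *m A = p *: b + q *: a -> q = 0.
Proof.
move=> symA nz aA bA.
have ab : (a *m A *m b^T) 0 0 = (b *m A *m a^T) 0 0.
  rewrite -[in RHS](trmxK (b *m A *m a^T)) [in RHS]mxE.
  by rewrite !trmx_mul trmxK symA mulmxA.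
have sw : (b *m a^T) 0 0 = (a *m b^T) 0 0.
  by rewrite -[in RHS](trmxK (a *m b^T)) [in RHS]mxE trmx_mul trmxK.
move: ab; rewrite aA bA mulmxBl mulmxDl -!scalemxAl.
move: sw (row_sqnorm_ge0 a) (row_sqnorm_ge0 b)
  (@row_sqnorm_gt0 _ a) (@row_sqnorm_gt0 _ b).
move: (b *m a^T) (a *m b^T) (a *m a^T) (b *m b^T) => X Y U V sw U0 V0 Up Vp.
rewrite !mxE sw => /addrI /eqP; rewrite eq_sym -subr_eq0 opprK -mulrDr.
rewrite mulf_eq0 => /orP[/eqP //|]; rewrite paddr_eq0 //.
by case/andP=> a0 b0; case/orP: nz => [/Up|/Vp]; rewrite lt0r ?a0 ?b0.
Qed.

(** Over the algebraically closed field of complex numbers over [R], the commuting family has a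
    common eigenvector [z = a + ib]. Splitting [z A = (p + iq) z] into real and imaginary parts and
    using [q = 0] makes each of [a] and [b] satisfy the eigenvector equation for the whole family,
    and at least one of them is nonzero. *)
Lemma common_real_eigenvector n (As : seq 'M[R]_n) : (0 < n)%N ->
  {in As, forall A, A^T = A} -> {in As &, forall A B, comm_mx A B} ->
  exists2 v : 'rV[R]_n, v != 0 &
    forall A, A \in As -> exists c, v *m A = c *: v.
Proof.
move=> n0 symA comA; pose f := real_complex R.
have [] := @common_eigenvector _ n [seq map_mx f A | A <- As] n0.
  move=> _ _ /mapP[A Ain ->] /mapP[B Bin ->].
  by rewrite /comm_mx -!map_mxM comA.
move=> z z0 /allP zP.
pose a := map_mx (@complex.Re R) z; pose b := map_mx (@complex.Im R) z.
have nz : (a != 0) || (b != 0).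
  rewrite -negb_and; apply: contra z0 => /andP[/eqP a0 /eqP b0].
  apply/eqP/rowP => i; have := congr1 (fun m : 'rV_n => m 0 i) a0.
  have := congr1 (fun m : 'rV_n => m 0 i) b0; rewrite !mxE.
  by case: (z 0 i) => x y /= -> ->.
have abA A : A \in As -> exists c, a *m A = c *: a /\ b *m A = c *: b.
  move=> Ain.
  have /eigenvectorP[[p q] /eigenspaceP zA] := zP _ (map_f (map_mx f) Ain).
  have aA : a *m A = p *: a - q *: b.
    apply/rowP => j; have := congr1 (fun m : 'rV_n => complex.Re (m 0 j)) zA.
    rewrite !mxE (raddf_sum (@complex.Re R)) /= => e.
    transitivity (complex.Re ((p +i* q)%C * z 0 j)).
      rewrite -e; apply: eq_bigr => k _; rewrite !mxE.
      by case: (z 0 k) => x y /=; rewrite mulr0 subr0.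
    by case: (z 0 j) => x y.
  have bA : b *m A = p *: b + q *: a.
    apply/rowP => j; have := congr1 (fun m : 'rV_n => complex.Im (m 0 j)) zA.
    rewrite !mxE (raddf_sum (@complex.Im R)) /= => e.
    transitivity (complex.Im ((p +i* q)%C * z 0 j)).
      rewrite -e; apply: eq_bigr => k _; rewrite !mxE.
      by case: (z 0 k) => x y /=; rewrite mulr0 add0r.
    by case: (z 0 j) => x y.
  have q0 := symmetric_eigenvalue_real (symA _ Ain) nz aA bA.
  by exists p; rewrite aA bA q0 !scale0r subr0 addr0.
by case/orP: nz => nz; [exists a|exists b] => // A /abA[c []]; exists c.
Qed.

(** The reflection in the hyperplane orthogonal to [w = v - e] exchanges the unit vectors [e] and
    [v]; when [v = e] the identity serves instead. *)
Lemma householder n (v : 'rV[R]_n.+1) : v *m v^T = 1%:M ->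
  exists H : 'M[R]_n.+1, [/\ H^T = H, H *m H = 1%:M & delta_mx 0 0 *m H = v].
Proof.
move=> v1; pose e : 'rV[R]_n.+1 := delta_mx 0 0; pose w := v - e.
have e1 : e *m e^T = 1%:M.
  by rewrite /e trmx_delta mul_delta_mx; apply/matrixP => i j; rewrite !ord1 !mxE.
have [w0|wn0] := eqVneq w 0.
  exists 1%:M; rewrite trmx1 mulmx1 mulmx1; split=> //.
  by apply/eqP; rewrite eq_sym -subr_eq0; apply/eqP.
have := row_sqnorm_gt0 wn0; set c := (w *m w^T) 0 0 => c0.
have cE : w *m w^T = c%:M by rewrite [LHS]mx11_scalar.
pose H := 1%:M - (2 / c) *: (w^T *m w).
(* Since [v] and [e] are unit vectors, [c = |v - e|^2 = 2 - 2 <e,v> = - 2 <e,w>]. Hence the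
   reflection sends [e] to [e + w = v]. *)
have ew : (2 / c) *: (e *m w^T) = - 1%:M.
  have cv : c%:M = - 2 *: (e *m w^T).
    have ve : v *m e^T = e *m v^T.
      by rewrite -[RHS]trmxK trmx_mul trmxK; apply/matrixP=> i j;
         rewrite !ord1 [RHS]mxE.
    have wT : w^T = v^T - e^T by rewrite /w linearB.
    rewrite -cE wT !mulmxBr /w !mulmxBl v1 e1 ve scalerBr !scaleNr !scaler_nat.
    by rewrite !mulr2n !opprB opprK opprD addrACA addrC.
  have : (- c^-1) *: c%:M = (- c^-1) *: (- 2 *: (e *m w^T)) :> 'M[R]_1 by rewrite cv.
  rewrite scalerA mulrNN mulrC => <-.
  by rewrite -mul_scalar_mx -scalar_mxM mulNr mulVf ?gt_eqF // raddfN.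
exists H; split.
- by rewrite /H linearB /= trmx1 linearZ /= trmx_mul trmxK.
- have tw : (2 / c) *: (w^T *m w) *m ((2 / c) *: (w^T *m w)) =
      (2 / c) *: (w^T *m w) *+ 2.
    rewrite -scalemxAl -scalemxAr mulmxA -(mulmxA w^T) cE mul_mx_scalar.
    rewrite -scalemxAl !scalerA -scaler_nat scalerA; congr (_ *: _).
    by field; rewrite gt_eqF.
  rewrite /H; move: ((2 / c) *: (w^T *m w)) tw => X XX.
  by rewrite mulmxBl mul1mx mulmxBr mulmx1 XX mulr2n opprB addrK subrK.
- rewrite /H -/e mulmxBr mulmx1 -scalemxAr mulmxA scalemxAl ew mulNmx mul1mx.
  by rewrite opprK /w addrC subrK.
Qed.

(* Reflect the common eigenvector onto the first basis vector, then recurse on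
   the lower right block. *)
Lemma symmetric_codiagonalization n (As : seq 'M[R]_n) :
  {in As, forall A, A^T = A} -> {in As &, forall A B, comm_mx A B} ->
  exists2 s : 'M[R]_n, s *m s^T = 1%:M &
    forall A, A \in As -> is_diag_mx (s *m A *m s^T).
Proof.
elim: n As => [|n IHn] As symA comA.
  exists 1%:M => [|A _]; first by rewrite trmx1 mulmx1.
  by apply/is_diag_mxP => -[].
have [v0 v0n vA0] := common_real_eigenvector (ltn0Sn n) symA comA.
pose v := (Num.sqrt ((v0 *m v0^T) 0 0))^-1 *: v0.
have v1 : v *m v^T = 1%:M.
  have := row_sqnorm_gt0 v0n; rewrite /v linearZ /= -scalemxAl -scalemxAr scalerA.
  rewrite [X in _ -> _ *: X = _]mx11_scalar; move: ((v0 *m v0^T) 0 0) => N vp.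
  by rewrite scale_scalar_mx -invfM -expr2 sqr_sqrtr ?ltW // mulVf ?gt_eqF.
have vA A : A \in As -> exists c, v *m A = c *: v.
  by move=> /vA0[c e]; exists c; rewrite /v -scalemxAl e !scalerA mulrC.
have [H [HT HH eH]] := householder v1.
have blk A : A \in As -> exists c, H *m A *m H =
    block_mx (c%:M : 'M_1) 0 0 (drsubmx (H *m A *m H : 'M_(1 + n))).
  move=> Ain; have [c vAc] := vA A Ain; exists c.
  (* With [e] the first basis vector, [e H = v] and [v H = e], so [e H A H = c e]. Symmetry then
     gives the first column as well, and the matrix splits into blocks of sizes 1 and [n]. *)
  have r0 : row 0 (H *m A *m H) = c *: delta_mx 0 0.
    by rewrite rowE 2!mulmxA eH vAc -scalemxAl -eH -mulmxA HH mulmx1.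
  have sy : (H *m A *m H)^T = H *m A *m H.
    by rewrite !trmx_mul HT symA // mulmxA.
  have E j : (H *m A *m H) 0 j = c *+ (j == 0).
    have := congr1 (fun m : 'rV_(n.+1) => m 0 j) r0; rewrite !mxE => ->.
    by rewrite eqxx /= mulr_natr.
  move: (H *m A *m H) E sy => B E sy.
  rewrite -[LHS](@submxK _ 1 n 1 n); congr (@block_mx _ 1 n 1 n _ _ _ _).
  - by apply/matrixP => i j; rewrite !ord1 !mxE lshift0 E eqxx.
  - by apply/matrixP => i j; rewrite !ord1 !mxE lshift0 E.
  - by apply/matrixP => i j; rewrite !ord1 -[in LHS]sy !mxE lshift0 E.
pose f A := drsubmx (H *m A *m H : 'M_(1 + n)).
have sub_sym : {in [seq f A | A <- As], forall B, B^T = B}.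
  by move=> _ /mapP[A Ain ->]; rewrite /f trmx_drsub !trmx_mul HT symA // mulmxA.
have sub_com : {in [seq f A | A <- As] &, forall A B, comm_mx A B}.
  move=> _ _ /mapP[A Ain ->] /mapP[B Bin ->].
  have [a Ea] := blk A Ain; have [b Eb] := blk B Bin.
  (* Conjugation by the involution [H] preserves commutation, and block diagonal matrices multiply
     blockwise, so the lower right blocks commute too. *)
  have /(congr1 (@drsubmx R 1 n 1 n)) :
      (H *m A *m H) *m (H *m B *m H) = (H *m B *m H) *m (H *m A *m H).
    rewrite !mulmxA -(mulmxA (H *m A) H H) -(mulmxA (H *m B) H H) HH !mulmx1.
    by rewrite -(mulmxA H A) -(mulmxA H B) (comA A B).
  by rewrite Ea Eb !(@mulmx_block R 1 n 1 n 1 n) !block_mxKdr !mul0mx !add0r.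
have [s' s'1 s'D] := IHn _ sub_sym sub_com.
pose P : 'M[R]_(1 + n) := block_mx 1%:M 0 0 s'.
exists (P *m H).
  rewrite trmx_mul HT mulmxA -(mulmxA P) HH mulmx1 /P
    (@tr_block_mx _ 1 n 1 n) (@mulmx_block R 1 n 1 n 1 n).
  by rewrite !trmx0 trmx1 !mulmx0 !mul0mx !addr0 !add0r mulmx1 s'1 -scalar_mx_block.
move=> A Ain; have [c Ac] := blk A Ain.
rewrite trmx_mul HT !mulmxA -(mulmxA P) -(mulmxA P) Ac /P
  (@tr_block_mx _ 1 n 1 n) !(@mulmx_block R 1 n 1 n 1 n).
rewrite !trmx0 trmx1 !(mulmx0, mul0mx, addr0, add0r, mulmx1, mul1mx).
by rewrite (@is_diag_block_mx _ 1 n 1 n) // !eqxx mx11_is_diag (s'D _ (map_f f Ain)).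
Qed.

End RealSpectral.

(** * Three-valued indices, slices and Frobenius products *)

Local Notation o0 := (@Ordinal 3 0 isT).
Local Notation o1 := (@Ordinal 3 1 isT).
Local Notation o2 := (@Ordinal 3 2 isT).

Lemma sum3E (R : nmodType) (F : 'I_3 -> R) :
  \sum_i F i = F o0 + F o1 + F o2.
Proof.
rewrite !big_ord_recl big_ord0 addr0 addrA.
by congr (_ + _ + _); congr F; apply: val_inj.
Qed.

(** The cases are the same closed literals that [sum3E] produces, so index tests such as [i == j]
    reduce by computation. *)
Lemma ord3P (P : 'I_3 -> Prop) : P o0 -> P o1 -> P o2 -> forall i, P i.
Proof.
move=> P0 P1 P2 [[|[|[|//]]] lti]; rewrite (bool_irrelevance lti isT) //.
Qed.

Section Tensors.
Variable R : realType.
Implicit Types (G D : tensor3 R) (s : 'M[R]_3) (x y : 'cV[R]_3).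

Definition slice D k : 'M[R]_3 := \matrix_(i, j) D i j k.
Definition inner x y : R := (x^T *m y) 0 0.
(** For symmetric [D] this is one third of the gradient of the cubic form [D(x,x,x)]; at [x = u] it
    is the vector [w]. *)
Definition cubic_grad D x : 'cV[R]_3 := \col_m (x^T *m slice D m *m x) 0 0.
Definition tcol G : 'cV[R]_3 := \col_i tvec G i.
Definition vcol G : 'cV[R]_3 := \col_i vvec G i.

Lemma trilinearC12 G i j k : trilinear G -> G i j k = G j i k.
Proof. by move=> hG; have [-> ->] := hG i j k. Qed.

Lemma trilinearC23 G i j k : trilinear G -> G i j k = G i k j.
Proof. by move=> hG; have [] := hG i j k. Qed.

Lemma innerE x y : inner x y = \sum_i x i 0 * y i 0.
Proof. by rewrite /inner mxE; apply: eq_bigr => i _; rewrite mxE. Qed.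

Lemma inner_mulmx (A : 'M[R]_3) x y :
  inner x (A *m y) = \sum_k \sum_l A k l * x k 0 * y l 0.
Proof.
rewrite innerE; apply: eq_bigr => k _; rewrite mxE mulr_sumr.
by apply: eq_bigr => l _; rewrite mulrA [x k 0 * _]mulrC.
Qed.

Lemma cubic_gradE D x m :
  cubic_grad D x m 0 = \sum_i \sum_j D i j m * x i 0 * x j 0.
Proof.
have -> : cubic_grad D x m 0 = inner x (slice D m *m x).
  by rewrite mxE /inner mulmxA.
by rewrite inner_mulmx; do 2!apply: eq_bigr => ? _; rewrite mxE.
Qed.

Lemma tr_mulmx_sum n (A B : 'M[R]_n) :
  \tr (A^T *m B) = \sum_i \sum_j A i j * B i j.
Proof.
rewrite /mxtrace exchange_big; apply: eq_bigr => i _; rewrite mxE.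
by apply: eq_bigr => j _; rewrite mxE.
Qed.

(** This exhibits [star2 D] as the Gram matrix of the slices for the Frobenius product, which is
    invariant under orthogonal conjugation. *)
Lemma star2E D k l : star2 D k l = \tr ((slice D k)^T *m slice D l).
Proof.
by rewrite mxE tr_mulmx_sum; do 2!apply: eq_bigr => ? _; rewrite !mxE.
Qed.

Lemma star2_sym D : (star2 D)^T = star2 D.
Proof.
by apply/matrixP => k l; rewrite !mxE; do 2!apply: eq_bigr => ? _; rewrite mulrC.
Qed.

Lemma vvecE G m : vvec G m = \tr ((star2 (tfree G))^T *m slice (tfree G) m).
Proof.
rewrite tr_mulmx_sum /vvec.
under eq_bigr do rewrite exchange_big; rewrite exchange_big; apply: eq_bigr => k _.
under eq_bigr do rewrite exchange_big; rewrite exchange_big; apply: eq_bigr => l _.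
rewrite !mxE mulr_suml; apply: eq_bigr => i _; rewrite mulr_suml.
by apply: eq_bigr => j _.
Qed.

(** * Invariants as matrix expressions *)

Section Invariants.
Variable G : tensor3 R.
Let D := tfree G.
Let M := star2 D.
Let u := tcol G.
Let v := vcol G.
Let w := cubic_grad D u.

Lemma wvecE m : wvec G m = w m 0.
Proof. by rewrite /w cubic_gradE; do 2!apply: eq_bigr => ? _; rewrite !mxE. Qed.

Lemma H2E : H2 G = \tr M.
Proof.
rewrite /H2 /mxtrace; under eq_bigr do rewrite exchange_big.
by rewrite exchange_big; apply: eq_bigr => k _; rewrite mxE.
Qed.

Lemma J2E : J2 G = inner u u.
Proof. by rewrite innerE; apply: eq_bigr => i _; rewrite !mxE. Qed.

(** Once the shared indices [k] and [l] are summed outermost, the sums over [i, j] and over [p, q]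
    separate into two factors [M k l]. The other invariants are factored by the same reordering. *)
Lemma H4E : H4 G = \tr (M *m M).
Proof.
rewrite -{1}[M](star2_sym D) tr_mulmx_sum /H4.
under eq_bigr do rewrite exchange_big; rewrite exchange_big; apply: eq_bigr => k _.
under eq_bigr do rewrite exchange_big; rewrite exchange_big; apply: eq_bigr => l _.
rewrite !mxE mulr_suml; apply: eq_bigr => i _; rewrite mulr_suml.
apply: eq_bigr => j _; rewrite mulr_sumr; apply: eq_bigr => p _.
by rewrite mulr_sumr; apply: eq_bigr => q _; rewrite !mulrA.
Qed.

Lemma J4E : J4 G = inner u (M *m u).
Proof.
rewrite inner_mulmx /J4.
under eq_bigr do rewrite exchange_big; rewrite exchange_big; apply: eq_bigr => k _.
under eq_bigr do rewrite exchange_big; rewrite exchange_big; apply: eq_bigr => l _.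
rewrite !mxE !mulr_suml; apply: eq_bigr => i _; rewrite !mulr_suml.
by apply: eq_bigr => j _; rewrite -/D; ring.
Qed.

Lemma K4E : K4 G = inner v u.
Proof.
rewrite innerE /K4.
under eq_bigr do under eq_bigr do under eq_bigr do rewrite exchange_big.
under eq_bigr do under eq_bigr do rewrite exchange_big.
under eq_bigr do rewrite exchange_big; rewrite exchange_big; apply: eq_bigr => p _.
rewrite !mxE !mulr_suml; apply: eq_bigr => i _; rewrite !mulr_suml.
apply: eq_bigr => j _; rewrite !mulr_suml; apply: eq_bigr => k _.
by rewrite !mulr_suml.
Qed.

Lemma L4E : L4 G = inner w u.
Proof.
rewrite innerE /L4.
under eq_bigr do rewrite exchange_big; rewrite exchange_big; apply: eq_bigr => k _.
rewrite cubic_gradE mulr_suml; apply: eq_bigr => i _; rewrite mulr_suml.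
by apply: eq_bigr => j _; rewrite !mxE.
Qed.

Lemma H6E : H6 G = inner v v.
Proof. by rewrite innerE; apply: eq_bigr => i _; rewrite !mxE. Qed.

Lemma K6E : K6 G = inner v w.
Proof. by rewrite innerE; apply: eq_bigr => i _; rewrite wvecE !mxE. Qed.

Lemma L6E : L6 G = inner u (M *m v).
Proof.
rewrite inner_mulmx /L6.
under eq_bigr do rewrite exchange_big; rewrite exchange_big; apply: eq_bigr => k _.
under eq_bigr do rewrite exchange_big; rewrite exchange_big; apply: eq_bigr => l _.
rewrite !mxE !mulr_suml; apply: eq_bigr => i _; rewrite !mulr_suml.
by apply: eq_bigr => j _.
Qed.

Lemma H10E : H10 G = inner (cubic_grad D v) v.
Proof.
rewrite innerE /H10.
under eq_bigr do rewrite exchange_big; rewrite exchange_big; apply: eq_bigr => k _.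
rewrite cubic_gradE mulr_suml; apply: eq_bigr => i _; rewrite mulr_suml.
by apply: eq_bigr => j _; rewrite !mxE.
Qed.

Lemma M6E : M6 G = inner w w.
Proof.
rewrite innerE /M6.
under eq_bigr do rewrite exchange_big; rewrite exchange_big; apply: eq_bigr => k _.
rewrite !cubic_gradE mulr_suml; apply: eq_bigr => i _; rewrite mulr_suml.
apply: eq_bigr => j _; rewrite mulr_sumr; apply: eq_bigr => p _.
rewrite mulr_sumr; apply: eq_bigr => q _; rewrite !mxE -/D; ring.
Qed.

Lemma H8E : H8 G = inner u (M *m (M *m v)).
Proof.
rewrite inner_mulmx /H8.
under eq_bigr do rewrite exchange_big; rewrite exchange_big; apply: eq_bigr => k _.
under eq_bigr do rewrite exchange_big; rewrite exchange_big; apply: eq_bigr => l _.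
rewrite [M k l]mxE !mulr_suml; apply: eq_bigr => i _; rewrite !mulr_suml.
apply: eq_bigr => j _; rewrite [(M *m v) l 0]mxE mulr_sumr.
under eq_bigr do rewrite exchange_big; rewrite exchange_big; apply: eq_bigr => r _.
rewrite [M l r]mxE mulr_suml mulr_sumr; apply: eq_bigr => p _.
rewrite mulr_suml mulr_sumr; apply: eq_bigr => q _.
by rewrite [u k 0]mxE [v r 0]mxE !mulrA.
Qed.

Hypothesis hG : trilinear G.

Lemma tfree_trilinear : trilinear D.
Proof.
move=> i j k; rewrite /D /tfree; have [-> ->] := hG i j k.
by rewrite (eq_sym k j) (eq_sym j i); split; ring.
Qed.

(** Symmetry of [D] enters because [J6] leaves the first index of its last factor free, whereas
    [cubic_grad] leaves the third. *)
Lemma J6E : J6 G = inner u (M *m w).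
Proof.
rewrite inner_mulmx /J6.
under eq_bigr do rewrite exchange_big; rewrite exchange_big; apply: eq_bigr => k _.
under eq_bigr do rewrite exchange_big; rewrite exchange_big; apply: eq_bigr => l _.
rewrite [M k l]mxE !mulr_suml; apply: eq_bigr => i _; rewrite !mulr_suml.
apply: eq_bigr => j _; rewrite cubic_gradE [RHS]mulr_sumr; apply: eq_bigr => p _.
rewrite [RHS]mulr_sumr; apply: eq_bigr => q _; rewrite !mxE.
by rewrite -/D (trilinearC12 l p q tfree_trilinear)
  (trilinearC23 p l q tfree_trilinear) !mulrA.
Qed.

End Invariants.

(** * The norm of the commutators *)

Definition commutator D k l : 'M[R]_3 :=
  slice D k *m slice D l - slice D l *m slice D k.

Lemma commutatorE G k l i j : commutator G k l i j =
  \sum_m (G i m k * G m j l - G i m l * G m j k).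
Proof. by rewrite !mxE sumrB; congr (_ - _); apply: eq_bigr => m _; rewrite !mxE. Qed.

Lemma antisymmetric_sqsum (F : 'I_3 -> 'I_3 -> R) :
  (forall i j, F j i = - F i j) ->
  \sum_i \sum_j F i j ^+ 2 = 2 * (F o0 o1 ^+ 2 + F o0 o2 ^+ 2 + F o1 o2 ^+ 2).
Proof.
move=> aF; have F0 i : F i i = 0.
  by have /eqP := aF i i; rewrite -subr_eq0 opprK -mulr2n mulrn_eq0 => /eqP.
rewrite !sum3E !F0 (aF o0 o1) (aF o0 o2) (aF o1 o2); ring.
Qed.

(** The factor 5 is dimension plus 2: the three correction terms contract to [3 u_i + u_i + u_i]. *)
Lemma tfree_trace G i : \sum_l tfree G i l l = 0.
Proof.
have := erefl (tvec G i); rewrite {1}/tvec !sum3E /tfree => e.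
move: i e; apply: ord3P => /= <-; ring.
Qed.

Lemma tfreeK G i j k : 5 * G i j k = tfree G i j k +
  (tvec G i * (j == k)%:R + tvec G j * (i == k)%:R + tvec G k * (i == j)%:R).
Proof. by rewrite /tfree subrK. Qed.

(** The commutator of two symmetric matrices is antisymmetric in [i, j], and exchanging the matrices
    makes it antisymmetric in [k, l]. The 81 squares thus reduce to 9, each counted four times. *)
Lemma commutator_sqsum G (c := commutator G) : trilinear G ->
  \sum_k \sum_l \sum_i \sum_j c k l i j ^+ 2 =
  4 * ((c o0 o1 o0 o1 ^+ 2 + c o0 o2 o0 o1 ^+ 2 + c o1 o2 o0 o1 ^+ 2)
     + (c o0 o1 o0 o2 ^+ 2 + c o0 o2 o0 o2 ^+ 2 + c o1 o2 o0 o2 ^+ 2)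
     + (c o0 o1 o1 o2 ^+ 2 + c o0 o2 o1 o2 ^+ 2 + c o1 o2 o1 o2 ^+ 2)).
Proof.
rewrite {}/c => hG.
have anti_ij k l i j : commutator G k l j i = - commutator G k l i j.
  rewrite !commutatorE -sumrN; apply: eq_bigr => m _.
  have C a b c := trilinearC12 a b c hG.
  by rewrite (C j m) (C j m) (C m i) (C m i); ring.
have anti_kl i j k l : commutator G l k i j = - commutator G k l i j.
  by rewrite /commutator -opprB mxE.
under eq_bigr => k _ do under eq_bigr => l _ do
  rewrite (antisymmetric_sqsum (anti_ij k l)).
under eq_bigr => k _ do rewrite -mulr_sumr !big_split /=.
rewrite -mulr_sumr !big_split /=.
rewrite (antisymmetric_sqsum (anti_kl o0 o1)) (antisymmetric_sqsum (anti_kl o0 o2))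
  (antisymmetric_sqsum (anti_kl o1 o2)).
ring.
Qed.

Lemma commutator_sqnorm G : trilinear G ->
  625 * (\sum_k \sum_l \sum_i \sum_j commutator G k l i j ^+ 2) =
  - H2 G ^+ 2 - 4 * (H2 G * J2 G) + 36 * J2 G ^+ 2
  + 4 * H4 G - 4 * J4 G - 8 * K4 G + 8 * L4 G.
Proof.
move=> hG; rewrite commutator_sqsum // H2E J2E H4E J4E K4E L4E.
rewrite -[X in \tr (X *m _)]star2_sym tr_mulmx_sum inner_mulmx !innerE /mxtrace.
have vE m : vcol G m 0 = \sum_k \sum_l star2 (tfree G) k l * tfree G k l m.
  by rewrite mxE vvecE tr_mulmx_sum; do 2!apply: eq_bigr => ? _;
     rewrite [slice _ _ _ _]mxE.
have wE m : cubic_grad (tfree G) (tcol G) m 0 =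
    \sum_i \sum_j tfree G i j m * tvec G i * tvec G j.
  by rewrite cubic_gradE; do 2!apply: eq_bigr => ? _; rewrite !mxE.
have uE m : tcol G m 0 = tvec G m by rewrite mxE.
have mE k l : star2 (tfree G) k l = \sum_i \sum_j tfree G i j k * tfree G i j l.
  by rewrite mxE.
move: (vcol G) (tcol G) (cubic_grad _ _) (star2 _) vE uE wE mE => v u w M vE uE wE mE.
have hD := tfree_trilinear hG.
have e0 i j k := trilinearC23 i j k hD; have e1 i j k := trilinearC12 i j k hD.
have t0 := tfree_trace G o0; have t1 := tfree_trace G o1; have t2 := tfree_trace G o2.
rewrite !sum3E in t0 t1 t2.
have cE k l i j : 25 * commutator G k l i j =
    \sum_m (5 * G i m k * (5 * G m j l) - 5 * G i m l * (5 * G m j k)).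
  by rewrite commutatorE mulr_sumr; apply: eq_bigr => m _; ring.
(* One factor 25 goes into each commutator entry: these are quadratic in [G], so [25 c] is a
   polynomial in [5 G], that is in [D] and [u], without denominators. *)
have -> : 625 = 25 ^+ 2 :> R by ring.
rewrite mulrCA !mulrDr -!exprMn !cE.
rewrite !sum3E !wE !vE !uE !sum3E.
rewrite !tfreeK [in LHS]/=.
move: (tfree G) (tvec G) mE e0 e1 t0 t1 t2 => D U mE e0 e1 t0 t1 t2.
rewrite !mE !sum3E.
(* Complete symmetry sorts the indices of every entry of [D] in increasing order, leaving ten
   entries. *)
rewrite !(e1 o1 o0) !(e1 o2 o0) !(e1 o2 o1) !(e0 _ o1 o0) !(e0 _ o2 o0) !(e0 _ o2 o1).
rewrite !(e1 o1 o0) !(e1 o2 o0) !(e1 o2 o1) in t0 t1 t2 *.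
rewrite !(e0 _ o1 o0) !(e0 _ o2 o0) !(e0 _ o2 o1) in t1 t2.
(* The three trace conditions eliminate the entries 022, 122 and 222. Seven free entries of [D] and
   three of [u] remain, and the claim becomes a polynomial identity in ten variables. *)
move/eqP: t0; rewrite addr_eq0 eq_sym eqr_oppLR => /eqP t0.
move/eqP: t1; rewrite addr_eq0 eq_sym eqr_oppLR => /eqP t1.
move/eqP: t2; rewrite addr_eq0 eq_sym eqr_oppLR => /eqP t2.
rewrite t0 t1 t2.
move: (D o0 o0 o0) (D o0 o0 o1) (D o0 o0 o2) (D o0 o1 o1) (D o0 o1 o2)
  (D o1 o1 o1) (D o1 o1 o2) (U o0) (U o1) (U o2) => a b c d e f g p q r.
ring.
Qed.

(** * Matrix form of the action on slices, and principal minors *)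

Lemma conjmx_trE n (s A : 'M[R]_n) i j :
  (s *m A *m s^T) i j = \sum_i' \sum_j' s i i' * s j j' * A i' j'.
Proof.
rewrite exchange_big mxE; apply: eq_bigr => j' _.
rewrite !mxE mulr_suml; apply: eq_bigr => i' _; ring.
Qed.

(** The first two indices conjugate each slice by [s], while the third forms linear combinations of
    the slices. *)
Lemma slice_act s D k :
  slice (tensor_act s D) k = \sum_k' s k k' *: (s *m slice D k' *m s^T).
Proof.
apply/matrixP => i j; rewrite mxE summxE /tensor_act.
under eq_bigr do rewrite exchange_big; rewrite exchange_big.
apply: eq_bigr => k' _; rewrite mxE conjmx_trE mulr_sumr.
apply: eq_bigr => i' _; rewrite mulr_sumr; apply: eq_bigr => j' _.
by rewrite !mxE; ring.
Qed.

Lemma slice_inj D D' : (forall k, slice D k = slice D' k) -> D = D'.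
Proof.
move=> e; apply/funext => i; apply/funext => j; apply/funext => k.
by have := congr1 (fun A : 'M_3 => A i j) (e k); rewrite !mxE.
Qed.

Lemma trilinear_act s G : trilinear G -> trilinear (tensor_act s G).
Proof.
move=> hG i j k.
have C23 a b c : tensor_act s G a b c = tensor_act s G a c b.
  rewrite /tensor_act; apply: eq_bigr => i' _; rewrite exchange_big.
  by do 2!apply: eq_bigr => ? _; rewrite (trilinearC23 _ _ _ hG); ring.
split=> //; rewrite C23 /tensor_act exchange_big.
by do 3!apply: eq_bigr => ? _; rewrite (trilinearC12 _ _ _ hG); ring.
Qed.

Lemma tcolE G : trilinear G -> tcol G = \col_i \tr (slice G i).
Proof.
move=> hG; apply/colP => i; rewrite !mxE; apply: eq_bigr => l _.
by rewrite !mxE (trilinearC12 _ _ _ hG) (trilinearC23 _ _ _ hG).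
Qed.

(** The Kronecker deltas become two rank one matrices and a scalar matrix, so equivariance of
    [tfree] can be checked by matrix algebra. *)
Lemma slice_tfree G k (e := delta_mx k 0 : 'cV[R]_3) :
  slice (tfree G) k = 5 *: slice G k
    - (tcol G *m e^T + e *m (tcol G)^T + (tcol G k 0)%:M).
Proof.
apply/matrixP => i j; rewrite !mxE !big_ord1 !mxE /tfree eqxx !andbT.
by rewrite -[tvec G k *+ _]mulr_natr [_%:R * tvec G j]mulrC.
Qed.

Lemma det2E (A : 'M[R]_2) : \det A = A 0 0 * A 1 1 - A 0 1 * A 1 0.
Proof.
rewrite (expand_det_row _ 0) !big_ord_recl big_ord0 /cofactor !det_mx11 !mxE /=.
have -> : lift (0 : 'I_2) (0 : 'I_1) = 1 by apply: val_inj.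
have -> : lift (1 : 'I_2) (0 : 'I_1) = 0 by apply: val_inj.
by rewrite expr0 expr1 addr0 mul1r mulN1r mulrN.
Qed.

(** This is Newton's identity for the second elementary symmetric function. Expressing it by traces
    makes its invariance under conjugation immediate. *)
Lemma sum_principal_minors2 (A : 'M[R]_3) :
  \sum_m \det (row' m (col' m A)) = (\tr A ^+ 2 - \tr (A *m A)) / 2.
Proof.
rewrite /mxtrace !sum3E !mxE !det2E !sum3E !mxE.
have -> : lift o0 (0 : 'I_2) = o1 by apply: val_inj.
have -> : lift o0 (1 : 'I_2) = o2 by apply: val_inj.
have -> : lift o1 (0 : 'I_2) = o0 by apply: val_inj.
have -> : lift o1 (1 : 'I_2) = o2 by apply: val_inj.
have -> : lift o2 (0 : 'I_2) = o0 by apply: val_inj.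
have -> : lift o2 (1 : 'I_2) = o1 by apply: val_inj.
by field.
Qed.

Lemma q2E D : q2 D = (q1 D ^+ 2 - \tr (star2 D *m star2 D)) / 2.
Proof. exact: sum_principal_minors2. Qed.

(** * Equivariance under the orthogonal group *)

Section Orthogonal.
Variables (s : 'M[R]_3) (hs : orthogonal_mx s).

Let sK : s^T *m s = 1%:M := hs.
Let Ks : s *m s^T = 1%:M.
Proof. exact: mulmx1C. Qed.

Lemma mxtrace_conj (A : 'M[R]_3) : \tr (s *m A *m s^T) = \tr A.
Proof. by rewrite mxtrace_mulC mulmxA sK mul1mx. Qed.

Lemma conj_mulmx (A B : 'M[R]_3) :
  (s *m A *m s^T) *m (s *m B *m s^T) = s *m (A *m B) *m s^T.
Proof. by rewrite !mulmxA -(mulmxA (s *m A)) sK mulmx1. Qed.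

Lemma inner_orthogonal x y : inner (s *m x) (s *m y) = inner x y.
Proof. by rewrite /inner trmx_mul mulmxA -(mulmxA x^T) sK mulmx1. Qed.

Lemma conj_mulmx_col (A : 'M[R]_3) (x : 'cV_3) :
  (s *m A *m s^T) *m (s *m x) = s *m (A *m x).
Proof. by rewrite !mulmxA -(mulmxA (s *m A)) sK mulmx1. Qed.

Lemma tcol_act G : trilinear G -> tcol (tensor_act s G) = s *m tcol G.
Proof.
move=> hG; rewrite !tcolE //; last exact: trilinear_act.
apply/colP => k; rewrite mxE slice_act raddf_sum !mxE.
by apply: eq_bigr => k' _; rewrite mxE /= mxtraceZ mxtrace_conj.
Qed.

Lemma tfree_act G : trilinear G ->
  tfree (tensor_act s G) = tensor_act s (tfree G).
Proof.
move=> hG; apply: slice_inj => k; rewrite slice_tfree !slice_act tcol_act //.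
set u := tcol G; set e := delta_mx k 0.
have se : \sum_k' s k k' *: delta_mx k' 0 = s^T *m e :> 'cV_3.
  apply/colP => i; rewrite -colE !mxE summxE (bigD1 i) //= !mxE !eqxx mulr1.
  by rewrite big1 ?addr0 // => l li; rewrite !mxE eq_sym (negbTE li) mulr0.
have su : \sum_k' s k k' * u k' 0 = (s *m u) k 0 by rewrite [RHS]mxE.
(* The basis vector [e] stays fixed while the slices mix. By [s s^T = 1] it expands in the columns
   of [s] with the same coefficients [s k k'], so the rank one corrections match term by term. *)
have eE : e = \sum_k' s k k' *: (s *m delta_mx k' 0).
  under eq_bigr do rewrite scalemxAr.
  by rewrite -mulmx_sumr se mulmxA Ks mul1mx.
symmetry; under eq_bigr => l _ do rewrite slice_tfree -/u mulmxBr mulmxBl scalerBr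
  -scalemxAr -scalemxAl scalerA [s k l * 5]mulrC -scalerA
  !mulmxDr !mulmxDl !scalerDr mul_mx_scalar -scalemxAl Ks scalerA.
rewrite sumrB scaler_sumr !big_split /=; congr (_ - (_ + _ + _)).
- by apply: eq_bigr => l _; rewrite scalerA.
- rewrite eE linear_sum /= mulmx_sumr; apply: eq_bigr => l _.
  by rewrite linearZ /= -scalemxAr trmx_mul !mulmxA.
- rewrite eE mulmx_suml; apply: eq_bigr => l _.
  by rewrite -scalemxAl trmx_mul !mulmxA.
- by under eq_bigr do rewrite scalerA; rewrite -scaler_suml su scale_scalar_mx mulr1.
Qed.

(** Bilinearity of the Gram matrix turns the mixing of slices into conjugation by [s], and the
    conjugation of each slice leaves the Frobenius products unchanged. *)
Lemma star2_act D : star2 (tensor_act s D) = s *m star2 D *m s^T.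
Proof.
apply/matrixP => k l; rewrite star2E !slice_act conjmx_trE.
rewrite [X in \tr (X *m _)]linear_sum mulmx_suml raddf_sum; apply: eq_bigr => a _.
rewrite mulmx_sumr raddf_sum; apply: eq_bigr => b _ /=.
rewrite [(_ *: _)^T]linearZ /= -scalemxAl -scalemxAr !mxtraceZ star2E mulrA.
by congr (_ * _); rewrite !trmx_mul trmxK mulmxA conj_mulmx mxtrace_conj.
Qed.

Lemma vcol_act G : trilinear G -> vcol (tensor_act s G) = s *m vcol G.
Proof.
move=> hG; apply/colP => k; rewrite mxE vvecE tfree_act // star2_act slice_act.
rewrite mulmx_sumr raddf_sum mxE; apply: eq_bigr => l _ /=.
rewrite -scalemxAr mxtraceZ [vcol G l 0]mxE vvecE; congr (_ * _).
by rewrite !trmx_mul trmxK mulmxA conj_mulmx mxtrace_conj.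
Qed.

Lemma cubic_grad_act D (x : 'cV_3) :
  cubic_grad (tensor_act s D) (s *m x) = s *m cubic_grad D x.
Proof.
apply/colP => k; rewrite mxE slice_act mulmx_sumr mulmx_suml summxE mxE.
apply: eq_bigr => l _; rewrite -scalemxAr -scalemxAl 2![in RHS]mxE [LHS]mxE.
congr (_ * _); rewrite trmx_mul -!mulmxA (mulmxA s^T s x) sK mul1mx.
by rewrite (mulmxA s^T s) sK mul1mx !mulmxA mxE.
Qed.

Variables (G : tensor3 R) (hG : trilinear G).
Let T := tensor_act s G.
Let hT : trilinear T := trilinear_act s hG.
Let actE := (tfree_act hG, star2_act, tcol_act hG, vcol_act hG, cubic_grad_act,
  conj_mulmx, conj_mulmx_col, mxtrace_conj, inner_orthogonal).

Lemma q1_act : q1 T = q1 G. Proof. by rewrite /q1 !actE. Qed.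
Lemma q3_act : q3 T = q3 G.
Proof.
by rewrite /q3 !actE !det_mulmx mulrAC -det_mulmx Ks det1 mul1r.
Qed.

Lemma q2_act : q2 T = q2 G.
Proof. by rewrite !q2E q1_act !actE. Qed.
Lemma H2_act : H2 T = H2 G. Proof. by rewrite !H2E !actE. Qed.
Lemma J2_act : J2 T = J2 G. Proof. by rewrite !J2E !actE. Qed.
Lemma H4_act : H4 T = H4 G. Proof. by rewrite !H4E !actE. Qed.
Lemma J4_act : J4 T = J4 G. Proof. by rewrite !J4E !actE. Qed.
Lemma K4_act : K4 T = K4 G. Proof. by rewrite !K4E !actE. Qed.
Lemma L4_act : L4 T = L4 G. Proof. by rewrite !L4E !actE. Qed.
Lemma H6_act : H6 T = H6 G. Proof. by rewrite !H6E !actE. Qed.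
Lemma J6_act : J6 T = J6 G. Proof. by rewrite !J6E // !actE. Qed.
Lemma K6_act : K6 T = K6 G. Proof. by rewrite !K6E !actE. Qed.
Lemma L6_act : L6 T = L6 G. Proof. by rewrite !L6E !actE. Qed.
Lemma M6_act : M6 T = M6 G. Proof. by rewrite !M6E !actE. Qed.
Lemma H8_act : H8 T = H8 G. Proof. by rewrite !H8E !actE. Qed.
Lemma H10_act : H10 T = H10 G. Proof. by rewrite !H10E !actE. Qed.

End Orthogonal.

(** * Diagonal tensors *)

Section Diagonal.
Variables (a b c : R) (T : tensor3 R).
Let l (i : 'I_3) : R := [:: a; b; c]`_i.
Hypothesis TE : forall i j k, T i j k = l i * ((i == j) && (j == k))%:R.

Let tvecE i : tvec T i = l i.
Proof.
by move: i; apply: ord3P; rewrite /tvec sum3E !TE /l /=; ring.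
Qed.

Let D i j k : tfree T i j k = 5 * (l i * ((i == j) && (j == k))%:R)
   - (l i * (j == k)%:R + l j * (i == k)%:R + l k * (i == j)%:R).
Proof. by rewrite /tfree !tvecE TE. Qed.

Let q := a ^+ 2 + b ^+ 2 + c ^+ 2.

Let star2D k m : star2 (tfree T) k m =
  (5 * l k ^+ 2 + 2 * q) * (k == m)%:R - l k * l m.
Proof.
rewrite mxE !sum3E !D /q; move: m; apply: ord3P; move: k; apply: ord3P;
rewrite /l /=; ring.
Qed.

Let uE i : tcol T i 0 = l i. Proof. by rewrite mxE. Qed.

Let vE i : vcol T i 0 = 10 * l i ^+ 3 - 2 * q * l i.
Proof.
rewrite mxE vvecE tr_mulmx_sum !sum3E !star2D ![slice _ _ _ _]mxE !D /q.
by move: i; apply: ord3P; rewrite /l /=; ring.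
Qed.

Let gradE x i : cubic_grad (tfree T) x i 0 =
  5 * l i * x i 0 ^+ 2 - 2 * (l o0 * x o0 0 + l o1 * x o1 0 + l o2 * x o2 0) * x i 0
  - l i * (x o0 0 ^+ 2 + x o1 0 ^+ 2 + x o2 0 ^+ 2).
Proof.
rewrite cubic_gradE !sum3E !D.
by move: i; apply: ord3P; rewrite /l /=; ring.
Qed.

Let star2T : star2 T = diag_mx (\row_i l i ^+ 2).
Proof.
apply/matrixP => k m; rewrite !mxE !sum3E !TE.
by move: m; apply: ord3P; move: k; apply: ord3P; rewrite /l /=; ring.
Qed.

Lemma q1_diag : q1 T = q.
Proof. by rewrite /q1 star2T mxtrace_diag sum3E !mxE. Qed.

Lemma q2_diag : q2 T = (a * b) ^+ 2 + (a * c) ^+ 2 + (b * c) ^+ 2.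
Proof.
rewrite q2E q1_diag star2T mulmx_diag mxtrace_diag sum3E !mxE /l /q /=.
by field.
Qed.

Lemma q3_diag : q3 T = (a * b * c) ^+ 2.
Proof.
rewrite /q3 star2T det_diag !big_ord_recl big_ord0 !mxE /l /=; ring.
Qed.

Let invE := (H2E, J2E, H4E, J4E, K4E, L4E, H6E, K6E, L6E, M6E, H8E, H10E).

Let hT : trilinear T.
Proof.
move=> i j k; rewrite !TE; move: k; apply: ord3P; move: j; apply: ord3P;
by move: i; apply: ord3P; rewrite /= ?mulr0.
Qed.

Lemma diagonal_relations :
  (H2 T = 10 * q1 T /\
   H4 T = 2 * (22 * q1 T ^+ 2 - 15 * q2 T) /\
   J2 T = q1 T /\
   L4 T = 2 * (q1 T ^+ 2 - 5 * q2 T) /\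
   H6 T = 4 * (16 * q1 T ^+ 3 - 55 * q1 T * q2 T + 75 * q3 T) /\
   H10 T = 8 * (128 * q1 T ^+ 5 - 700 * q1 T ^+ 3 * q2 T
                + 725 * q1 T * q2 T ^+ 2 + 950 * q1 T ^+ 2 * q3 T
                - 875 * q2 T * q3 T) /\
   J4 T = 2 * (3 * q1 T ^+ 2 - 5 * q2 T) /\
   K4 T = 4 * (2 * q1 T ^+ 2 - 5 * q2 T) /\
   J6 T = 12 * q1 T ^+ 3 - 55 * q1 T * q2 T + 75 * q3 T /\
   K6 T = 2 * (8 * q1 T ^+ 3 - 35 * q1 T * q2 T + 75 * q3 T) /\
   L6 T = 6 * (8 * q1 T ^+ 3 - 25 * q1 T * q2 T + 25 * q3 T) /\
   M6 T = 4 * q1 T ^+ 3 - 15 * q1 T * q2 T + 75 * q3 T /\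
   H8 T = 4 * (72 * q1 T ^+ 4 - 270 * q1 T ^+ 2 * q2 T
               + 75 * q2 T ^+ 2 + 325 * q1 T * q3 T)).
Proof.
(* [M] is a diagonal matrix minus the rank one matrix [l l^T]. This closed form handles every
   application of [M], including the iterated one in [H8], and leaves polynomial identities in
   [a, b, c]. *)
have Mx x k : (star2 (tfree T) *m x) k 0 =
    (5 * l k ^+ 2 + 2 * q) * x k 0
    - l k * (l o0 * x o0 0 + l o1 * x o1 0 + l o2 * x o2 0).
  by rewrite mxE sum3E !star2D; move: k; apply: ord3P; rewrite /=; ring.
rewrite !invE J6E // q1_diag q2_diag q3_diag.
rewrite -[X in \tr (X *m _)]star2_sym tr_mulmx_sum /mxtrace.
rewrite !innerE !sum3E !(Mx, gradE) !star2D !vE !uE /l /q /=.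
do !split; ring.
Qed.

End Diagonal.
End Tensors.

(** * From decoupling to the relations, and from the relations to commuting slices *)

Theorem theorem7p1 (R : realType) (G : tensor3 R) (hG : trilinear G) :
  fully_decoupleable G <->
  (H2 G = 10 * q1 G /\
   H4 G = 2 * (22 * q1 G ^+ 2 - 15 * q2 G) /\
   J2 G = q1 G /\
   L4 G = 2 * (q1 G ^+ 2 - 5 * q2 G) /\
   H6 G = 4 * (16 * q1 G ^+ 3 - 55 * q1 G * q2 G + 75 * q3 G) /\
   H10 G = 8 * (128 * q1 G ^+ 5 - 700 * q1 G ^+ 3 * q2 G
                + 725 * q1 G * q2 G ^+ 2 + 950 * q1 G ^+ 2 * q3 G
                - 875 * q2 G * q3 G) /\
   J4 G = 2 * (3 * q1 G ^+ 2 - 5 * q2 G) /\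
   K4 G = 4 * (2 * q1 G ^+ 2 - 5 * q2 G) /\
   J6 G = 12 * q1 G ^+ 3 - 55 * q1 G * q2 G + 75 * q3 G /\
   K6 G = 2 * (8 * q1 G ^+ 3 - 35 * q1 G * q2 G + 75 * q3 G) /\
   L6 G = 6 * (8 * q1 G ^+ 3 - 25 * q1 G * q2 G + 25 * q3 G) /\
   M6 G = 4 * q1 G ^+ 3 - 15 * q1 G * q2 G + 75 * q3 G /\
   H8 G = 4 * (72 * q1 G ^+ 4 - 270 * q1 G ^+ 2 * q2 G
               + 75 * q2 G ^+ 2 + 325 * q1 G * q3 G)).
Proof.
split=> [[s [hs dg]]|].
  pose T := tensor_act s G.
  rewrite -(q1_act hs) -(q2_act hs) -(q3_act hs) -(H2_act hs hG)
    -(J2_act hs hG) -(H4_act hs hG) -(J4_act hs hG) -(K4_act hs hG)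
    -(L4_act hs hG) -(H6_act hs hG) -(J6_act hs hG) -(K6_act hs hG)
    -(L6_act hs hG) -(M6_act hs hG) -(H8_act hs hG) -(H10_act hs hG).
  apply: (@diagonal_relations R (T o0 o0 o0) (T o1 o1 o1) (T o2 o2 o2)) => i j k.
  case: (eqVneq i j) => [<-{j}|ij] /=; last first.
    by rewrite dg ?mulr0 // => -[/eqP]; rewrite (negbTE ij).
  case: (eqVneq i k) => [<-{k}|ik] /=; last first.
    by rewrite dg ?mulr0 // => -[_ /eqP]; rewrite (negbTE ik).
  by rewrite mulr1; move: i; apply: ord3P.
case=> h2 [h4 [j2 [l4 [_ [_ [j4 [k4 _]]]]]]].
have N0 : \sum_k \sum_l \sum_i \sum_j commutator G k l i j ^+ 2 = 0.
  (* After substitution the coefficients of [q1^2] are [-100 - 40 + 36 + 176 - 24 - 64 + 16 = 0],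
     and those of [q2] are [-120 + 40 + 160 - 80 = 0]. *)
  have := commutator_sqnorm hG; rewrite h2 h4 j2 l4 j4 k4 => e.
  apply: (@mulfI _ (625 : R)); first by rewrite pnatr_eq0.
  by rewrite e mulr0; ring.
have comm0 k l : comm_mx (slice G k) (slice G l).
  apply/eqP; rewrite -subr_eq0; apply/eqP/matrixP => i j; rewrite [RHS]mxE.
  (* A vanishing sum of nonnegative terms has vanishing terms. Nonnegativity is recorded for each
     nesting level, so that the four sums can be peeled off one at a time. *)
  have ge0 k' l' i' : 0 <= \sum_j' commutator G k' l' i' j' ^+ 2.
    by apply: sumr_ge0 => ? _; apply: sqr_ge0.
  have ge0' k' l' : 0 <= \sum_i' \sum_j' commutator G k' l' i' j' ^+ 2.
    by apply: sumr_ge0.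
  have ge0'' k' : 0 <= \sum_l' \sum_i' \sum_j' commutator G k' l' i' j' ^+ 2.
    by apply: sumr_ge0.
  move/eqP: N0; rewrite psumr_eq0 // => /allP/(_ k (mem_index_enum _))/=.
  rewrite psumr_eq0 // => /allP/(_ l (mem_index_enum _))/=.
  rewrite psumr_eq0 // => /allP/(_ i (mem_index_enum _))/=.
  rewrite psumr_eq0 => [|? _]; last exact: sqr_ge0.
  move=> /allP/(_ j (mem_index_enum _))/=.
  by rewrite sqrf_eq0 => /eqP.
have [] := @symmetric_codiagonalization R 3 [seq slice G k | k <- enum 'I_3].
- move=> _ /mapP[k _ ->]; apply/matrixP => i j.
  by rewrite !mxE (trilinearC12 _ _ _ hG).
- by move=> _ _ /mapP[k _ ->] /mapP[l _ ->].
move=> s ss sD; exists s; split; first exact: mulmx1C.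
(* Every slice of the transformed tensor is a linear combination of the diagonal matrices [s A s^T],
   hence diagonal. *)
have act0 i j k : i != j -> tensor_act s G i j k = 0.
  move=> ij; have -> : tensor_act s G i j k = slice (tensor_act s G) k i j.
    by rewrite mxE.
  rewrite slice_act summxE big1 // => l _; rewrite mxE.
  have /is_diag_mxP -> // := sD _ (map_f (slice G) (mem_enum 'I_3 l)).
  by rewrite mulr0.
(* If [i = j], then [k] differs from them; exchanging the last two indices by symmetry brings the
   entry back to the case of distinct first indices. *)
move=> i j k nd; have [e|/act0->//] := eqVneq i j; rewrite -{j}e in nd *.
rewrite (trilinearC23 _ _ _ (trilinear_act s hG)); apply: act0.
by apply: contra_notN nd => /eqP.
Qed.
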